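(* Let $(\Omega,S)$ be a schurian pseudocyclic scheme of valency $k>1$ and rank greater than $2(k-1)$. Then $(\Omega,S)$ is a Frobenius scheme, and its automorphism group $\mathrm{Aut}(\Omega,S)$ is a Frobenius group.
   Context: A coherent configuration is a pair $(\Omega,S)$ where $\Omega$ is a finite set and $S$ is a partition of $\Omega\times\Omega$ such that the diagonal $1_\Omega$ is a union of elements of $S$, $S$ is closed under transposition, and for $r,s,t\in S$ the number $c_{rs}^t=|\{\beta:(\alpha,\beta)\in r,(\beta,\gamma)\in s\}|$ does not depend on $(\alpha,\gamma)\in t$. A scheme is a coherent configuration with $1_\Omega\in S$; rank is $|S|$; $S^\#=S\setminus\{1_\Omega\}$; valency $n_s=|\{\beta:(\alpha,\beta)\in s\}|$. With $\mathcal P$ the set of central primitive idempotents of the adjacency algebra $\mathbb{C}S$ (spanned by adjacency matrices), $n_P$ the dimension of an irreducible submodule of $\mathbb{C}^\Omega$ corresponding to $P$, $m_P=\operatorname{rk}(P)/n_P$ and $\mathcal P^\#=\mathcal P\setminus\{\frac1{|\Omega|}J\}$, the scheme is pseudocyclic if $m_P/n_P$ is constant on $\mathcal P^\#$; a pseudocyclic scheme has $n_s=k$ for all $s\in S^\#$ for some $k$, its valency. $\mathrm{Aut}(\Omega,S)=\{f\in\mathrm{Sym}(\Omega): s^f=s\ \forall s\in S\}$. The scheme of a transitive group $G\le\mathrm{Sym}(\Omega)$ is $(\Omega,\text{orbits of }G\text{ on }\Omega\times\Omega)$; a scheme is schurian if it is the scheme of some permutation group on $\Omega$. A Frobenius group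 is a non-regular transitive permutation group in which only the identity fixes two distinct points; a Frobenius scheme is the scheme of a Frobenius group. *)

(* Defs.v *)
From HB Require Import structures.
From mathcomp Require Import all_boot all_order all_algebra all_fingroup all_field.
Set Implicit Arguments.
Unset Strict Implicit.
Unset Printing Implicit Defensive.
Import Order.TTheory GRing.Theory Num.Theory.

Local Open Scope ring_scope.

Section Schemes.
Variable T : finType.

Definition diag : {set T * T} := [set p : T * T | p.1 == p.2].

Definition rtrans (s : {set T * T}) : {set T * T} := [set (p.2, p.1) | p in s].

Definition isect_count (r s : {set T * T}) (x : T * T) : nat :=
  #|[set b : T | ((x.1, b) \in r) && ((b, x.2) \in s)]|.

Definition is_scheme (S : {set {set T * T}}) : Prop :=
  [/\ partition S [set: T * T],
      diag \in S,
      (forall s, s \in S -> rtrans s \in S) &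
      (forall r s t, r \in S -> s \in S -> t \in S ->
         forall x y, x \in t -> y \in t -> isect_count r s x = isect_count r s y)].

Definition valency_at (s : {set T * T}) (a : T) : nat := #|[set b | (a, b) \in s]|.

Definition adjmx (s : {set T * T}) : 'M[algC]_#|T| :=
  \matrix_(i, j) ((((enum_val i : T), (enum_val j : T)) \in s)%:R).

Definition adj_alg (S : {set {set T * T}}) : 'A[algC]_#|T| :=
  (\sum_(s in S) <<mxvec (adjmx s)>>)%MS.

Definition central_in (S : {set {set T * T}}) (E : 'M[algC]_#|T|) : Prop :=
  forall A : 'M[algC]_#|T|, (A \in adj_alg S)%MS -> E *m A = A *m E.

Definition central_prim_idem (S : {set {set T * T}}) (P : 'M[algC]_#|T|) : Prop :=
  [/\ (P \in adj_alg S)%MS, P *m P = P, P != 0, central_in S P &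
      forall E : 'M[algC]_#|T|, (E \in adj_alg S)%MS -> E *m E = E ->
        central_in S E -> E *m P = 0 \/ E *m P = P].

Definition Jn : 'M[algC]_#|T| := (#|T|%:R)^-1 *: const_mx 1.

(* Subspaces of C^Omega (column vectors) are encoded by the row space of U
   (the rows of U are the transposed vectors). U is a CS-submodule iff
   A_s w is in it for every w in it, i.e. U *m (A_s)^T <= U. *)
Definition submodule (S : {set {set T * T}}) (U : 'M[algC]_#|T|) : Prop :=
  forall s, s \in S -> (U *m (adjmx s)^T <= U)%MS.

Definition irr_submodule (S : {set {set T * T}}) (U : 'M[algC]_#|T|) : Prop :=
  [/\ submodule S U, U != 0 &
      forall V : 'M[algC]_#|T|, submodule S V -> (V <= U)%MS ->
        V = 0 \/ (U <= V)%MS].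

(* U corresponds to P: P acts as the identity on U (P w = w for w in U) *)
Definition corresponds (P U : 'M[algC]_#|T|) : Prop := (U <= P^T)%MS.

(* pseudocyclic: m_P / n_P = rk(P) / n_P^2 is constant on P^#, where n_P is the
   dimension of an irreducible submodule corresponding to P *)
Definition pseudocyclic (S : {set {set T * T}}) : Prop :=
  exists c : rat, forall P U : 'M[algC]_#|T|,
    central_prim_idem S P -> P != Jn -> irr_submodule S U -> corresponds P U ->
    ((\rank P)%:R / ((\rank U)%:R ^+ 2) = c :> rat).

Definition orbitals (G : {set {perm T}}) : {set {set T * T}} :=
  [set [set ((g : {perm T}) x.1, g x.2) | g in G] | x in [set: T * T]].

Definition schurian (S : {set {set T * T}}) : Prop :=
  exists G : {group {perm T}}, [transitive G, on [set: T] | 'P] /\ orbitals G = S.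

Definition frobenius_perm (G : {set {perm T}}) : Prop :=
  [/\ [transitive G, on [set: T] | 'P],
      (exists2 g, g \in G & g != 1%g /\ exists x, g x = x) &
      (forall g, g \in G -> forall x y, x != y -> g x = x -> g y = y -> g = 1%g)].

Definition frobenius_scheme (S : {set {set T * T}}) : Prop :=
  exists G : {group {perm T}}, frobenius_perm G /\ orbitals G = S.

Definition aut_scheme (S : {set {set T * T}}) : {set {perm T}} :=
  [set f : {perm T} | [forall s in S, [set (f p.1, f p.2) | p in s] == s]].

End Schemes.

(* Main.v *)
Require Import Defs.
From HB Require Import structures.
From mathcomp Require Import all_boot all_order all_algebra all_fingroup all_field.
From mathcomp Require Import all_character zify ring.

(**
   Let G be a transitive group whose scheme is S, let pi be its permutation
   character, c the constant m_P / n_P and n = |Omega|. The adjacency algebra is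
   the commutant of G, so the central primitive idempotents are the isotypic
   projections P_chi of the constituents chi of pi; here m_P = chi(1) and
   n_P = (pi, chi). As chi(1) = c (pi, chi) for chi <> 1, summing the P_chi gives
     I - J/n = (c / |G|) sum_g (pi(g) - 1) g.
   All nondiagonal orbitals have valency k, so all two-point stabilisers have the
   same order m, with |G_x| = k m. Reading off a diagonal entry gives c = k, and
   an (x, y) entry with x <> y gives sum_(g : x -> y) pi(g) = (k - 1) m. For
   z fixed by h and x moved by h, the coset G_(xz) h consists of m elements which
   map x to h x and fix z; hence a nonidentity h fixes at most k - 1 points.
   Counting fixed points of elements of G_x then yields
     (n - 1) (m - 1) <= (k m - 1) (k - 2),
   where n - 1 = k (|S| - 1), so that m = 1 once |S| > 2 (k - 1). This applies to
   G = Aut(S), whose scheme is S because S is schurian.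
*)

Set Implicit Arguments.
Unset Strict Implicit.
Unset Printing Implicit Defensive.
Import Order.TTheory GRing.Theory Num.Theory.
Local Open Scope ring_scope.

(** For a full-rank factorization [P = C *m B], cancelling in [P *m P = P] leaves [B *m C = 1%:M],
    of size [\rank P]. *)
Lemma mxtrace_idem (F : fieldType) (n : nat) (P : 'M[F]_n) :
  P *m P = P -> \tr P = (\rank P)%:R.
Proof.
move=> PP; have [C [B [PE [C' C'C] fB]]] :
    exists C : 'M[F]_(n, \rank P), exists B : 'M[F]_(\rank P, n),
    [/\ P = C *m B, exists C', C' *m C = 1%:M & row_free B].
  exists (col_base P), (row_base P); rewrite mulmx_base row_base_free.
  by split=> //; apply/row_fullP/col_base_full.
have BC : B *m C = 1%:M.
  apply: (row_free_inj fB); rewrite mul1mx.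
  have : C' *m (C *m B *m (C *m B)) = C' *m (C *m B) by rewrite -PE PP.
  by rewrite !mulmxA C'C !mul1mx.
by rewrite {1}PE mxtrace_mulC BC mxtrace1.
Qed.

(** * Matrix units of an irreducible representation and isotypic projections *)

Section MatrixUnits.

Variables (gT : finGroupType) (G : {group gT}) (n d : nat).
Variables (rG : mx_representation algC G n) (D : mx_representation algC G d).
Hypothesis irrD : mx_irreducible D.

(* The elements of the group algebra that D sends to the matrix units, and every
   other irreducible representation to 0, as they act through rG. *)
Definition mxunit (a b : 'I_d) : 'M[algC]_n :=
  (d%:R / #|G|%:R) *: \sum_(g in G) D g^-1%g b a *: rG g.

Lemma mul_repr_mxunit h a b : h \in G ->
  rG h *m mxunit a b = \sum_c D h c a *: mxunit c b.
Proof.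
move=> Gh; transitivity ((d%:R / #|G|%:R) *:
    \sum_(g in G) (\sum_c D h c a * D g^-1%g b c) *: rG g); last first.
  under [RHS]eq_bigr do rewrite scalerA mulrC -scalerA scaler_sumr.
  rewrite -scaler_sumr exchange_big; congr (_ *: _); apply: eq_bigr => g Gg.
  by rewrite scaler_suml; apply: eq_bigr => c _; rewrite scalerA.
rewrite -scalemxAr mulmx_sumr; congr (_ *: _).
rewrite [RHS](reindex_inj (mulgI h)) /=.
apply: eq_big => [g|g Gg]; first by rewrite groupMl.
rewrite -scalemxAr -repr_mxM //; congr (_ *: _).
have Gg' : (h * g)%g^-1%g \in G by rewrite groupV groupM.
have -> : g^-1%g = ((h * g)^-1 * h)%g by rewrite invMg mulgKV.
by rewrite repr_mxM // mxE; apply: eq_bigr => c _; rewrite mulrC.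
Qed.

Lemma mul_mxunit_repr h a b : h \in G ->
  mxunit a b *m rG h = \sum_c D h b c *: mxunit a c.
Proof.
move=> Gh; transitivity ((d%:R / #|G|%:R) *:
    \sum_(g in G) (\sum_c D h b c * D g^-1%g c a) *: rG g); last first.
  under [RHS]eq_bigr do rewrite scalerA mulrC -scalerA scaler_sumr.
  rewrite -scaler_sumr exchange_big; congr (_ *: _); apply: eq_bigr => g Gg.
  by rewrite scaler_suml; apply: eq_bigr => c _; rewrite scalerA.
rewrite -scalemxAl mulmx_suml; congr (_ *: _).
rewrite [RHS](reindex_inj (mulIg h)) /=.
apply: eq_big => [g|g Gg]; first by rewrite groupMr.
rewrite -scalemxAl -repr_mxM //; congr (_ *: _).
have Gg' : (g * h)%g^-1%g \in G by rewrite groupV groupM.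
have -> : g^-1%g = (h * (g * h)^-1)%g by rewrite invMg mulKVg.
by rewrite repr_mxM // mxE.
Qed.

Lemma irr_dim_neq0 : d%:R != 0 :> algC.
Proof. by case/mx_irrP: irrD; rewrite pnatr_eq0 -lt0n. Qed.

(** Schur orthogonality: averaging [delta_mx a c] over conjugation by [D] gives a scalar matrix,
    whose scalar is read off the trace. *)
Lemma schur_coef a b c e :
  \sum_(h in G) D h^-1%g b a * D h c e
  = (a == c)%:R * (b == e)%:R * (#|G|%:R / d%:R).
Proof.
pose X := \sum_(h in G) D h^-1%g *m delta_mx a c *m D h.
have cX : centgmx D X.
  apply/centgmxP => g Gg; rewrite mulmx_suml mulmx_sumr.
  rewrite (reindex_inj (mulIg g^-1%g)) /=; apply: eq_big => [h|h Gh].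
    by rewrite groupMr ?groupV.
  have {}Gh : h \in G by move: Gh; rewrite groupMr ?groupV.
  rewrite invMg invgK !repr_mxM ?groupV // -!mulmxA.
  by rewrite -repr_mxM ?groupV // mulVg repr_mx1 mulmx1.
have absD : mx_absolutely_irreducible D by apply: groupC.
have /is_scalar_mxP[x Xx] := mx_abs_irr_cent_scalar absD cX.
have trX : \tr X = #|G|%:R * (a == c)%:R.
  rewrite /X raddf_sum /= (eq_bigr (fun _ => (a == c)%:R)); last first.
    move=> h Gh; rewrite mxtrace_mulC mulmxA -repr_mxM ?groupV // mulgV.
    rewrite repr_mx1 mul1mx /mxtrace (bigD1 a) //= big1 ?addr0 ?mxE ?eqxx //.
    by move=> i /negPf ai; rewrite mxE ai.
  by rewrite sumr_const mulr_natl.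
have xE : x = #|G|%:R * (a == c)%:R / d%:R.
  by rewrite -trX Xx mxtrace_scalar -[x *+ d]mulr_natr mulfK ?irr_dim_neq0.
transitivity (X b e); last first.
  rewrite Xx mxE xE; case: (b == e); last by rewrite mulr0n mulr0 mul0r.
  by rewrite mulr1n mulr1 mulrA [in RHS](mulrC _ #|G|%:R).
rewrite /X summxE; apply: eq_bigr => h _.
rewrite mxE (bigD1 c) //= big1 ?addr0 => [|i ic]; last first.
  by rewrite mxE big1 ?mul0r // => j _; rewrite mxE (negPf ic) andbF mulr0.
rewrite mxE (bigD1 a) //= big1 ?addr0 => [|i ia]; last first.
  by rewrite mxE (negPf ia) mulr0.
by rewrite mxE !eqxx mulr1.
Qed.

Lemma mul_mxunit a b c e :
  mxunit a b *m mxunit c e = (b == c)%:R *: mxunit a e.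
Proof.
rewrite {1}/mxunit -scalemxAl mulmx_suml.
transitivity ((d%:R / #|G|%:R) *:
    \sum_f (\sum_(h in G) D h^-1%g b a * D h f c) *: mxunit f e).
  congr (_ *: _); under [RHS]eq_bigr do rewrite scaler_suml.
  rewrite exchange_big; apply: eq_bigr => h Gh /=.
  rewrite -scalemxAl mul_repr_mxunit // scaler_sumr.
  by apply: eq_bigr => f _; rewrite scalerA.
rewrite (bigD1 a) //= [X in _ + X]big1 ?addr0 => [|f fa]; last first.
  by rewrite schur_coef eq_sym (negPf fa) !mul0r scale0r.
rewrite schur_coef eqxx mul1r scalerA mulrCA.
have -> : d%:R / #|G|%:R * (#|G|%:R / d%:R) = 1 :> algC.
  by rewrite mulrA mulfVK ?neq0CG // mulfV ?irr_dim_neq0.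
by rewrite mulr1.
Qed.

(** The projection onto the [D]-isotypic component of [rG]. *)
Definition isotypic_idem : 'M[algC]_n := \sum_a mxunit a a.

Lemma isotypic_idemE :
  isotypic_idem = (d%:R / #|G|%:R) *: \sum_(g in G) \tr (D g^-1%g) *: rG g.
Proof.
rewrite /isotypic_idem /mxunit -scaler_sumr exchange_big; congr (_ *: _).
by apply: eq_bigr => g _; rewrite /= -scaler_suml.
Qed.

Lemma mul_isotypic_mxunit a b : isotypic_idem *m mxunit a b = mxunit a b.
Proof.
rewrite mulmx_suml (bigD1 a) //= big1 ?addr0 => [|c ca].
  by rewrite mul_mxunit eqxx scale1r.
by rewrite mul_mxunit (negPf ca) scale0r.
Qed.

Lemma isotypic_idemK : isotypic_idem *m isotypic_idem = isotypic_idem.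
Proof.
by rewrite {2}/isotypic_idem mulmx_sumr; apply: eq_bigr => a _;
   rewrite mul_isotypic_mxunit.
Qed.

Lemma isotypic_comm h : h \in G ->
  rG h *m isotypic_idem = isotypic_idem *m rG h.
Proof.
move=> Gh; rewrite mulmx_sumr mulmx_suml.
under eq_bigr do rewrite mul_repr_mxunit //.
under [RHS]eq_bigr do rewrite mul_mxunit_repr //.
by rewrite exchange_big.
Qed.

Definition centralizes_repr (A : 'M[algC]_n) :=
  forall h, h \in G -> A *m rG h = rG h *m A.

Lemma commutes_mxunit A a b :
  centralizes_repr A -> A *m mxunit a b = mxunit a b *m A.
Proof.
move=> cA; rewrite /mxunit -scalemxAr -scalemxAl mulmx_sumr mulmx_suml.
congr (_ *: _); apply: eq_bigr => g Gg.
by rewrite -scalemxAr -scalemxAl cA.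
Qed.

Lemma commutes_isotypic A :
  centralizes_repr A -> A *m isotypic_idem = isotypic_idem *m A.
Proof.
move=> cA; rewrite mulmx_sumr mulmx_suml.
by apply: eq_bigr => a _; apply: commutes_mxunit.
Qed.

Lemma mxtrace_mxunit a b : \tr (mxunit a a) = \tr (mxunit b b).
Proof.
have -> : mxunit a a = mxunit a b *m mxunit b a.
  by rewrite mul_mxunit eqxx scale1r.
by rewrite mxtrace_mulC mul_mxunit eqxx scale1r.
Qed.

(** The diagonal units are idempotents of equal trace, so the [d] of them share the rank equally;
    the common rank is the multiplicity of [D] in [rG]. *)
Lemma mxrank_isotypic a : \rank isotypic_idem = (d * \rank (mxunit a a))%N.
Proof.
apply/eqP; rewrite -(eqr_nat algC) natrM.
rewrite -!mxtrace_idem ?isotypic_idemK //; last first.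
  by rewrite mul_mxunit eqxx scale1r.
rewrite {1}/isotypic_idem raddf_sum /= (eq_bigr (fun _ => \tr (mxunit a a))).
  by rewrite sumr_const card_ord mulr_natl.
by move=> b _; apply: mxtrace_mxunit.
Qed.

(* Turns an arbitrary Y into an element of the commutant that acts on the image of
   [mxunit a a] as the compression of Y. *)
Definition spread a (Y : 'M[algC]_n) : 'M[algC]_n :=
  \sum_b mxunit b a *m Y *m mxunit a b.

Lemma spread_mxunit a Y b c :
  spread a Y *m mxunit b c = mxunit b a *m Y *m mxunit a c.
Proof.
rewrite mulmx_suml (bigD1 b) //= big1 ?addr0 => [|f fb].
  by rewrite -mulmxA mul_mxunit eqxx scale1r.
by rewrite -mulmxA mul_mxunit (negPf fb) scale0r mulmx0.
Qed.

Lemma mxunit_spread a Y b c :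
  mxunit b c *m spread a Y = mxunit b a *m Y *m mxunit a c.
Proof.
rewrite mulmx_sumr (bigD1 c) //= big1 ?addr0 => [|f fc].
  by rewrite !mulmxA mul_mxunit eqxx scale1r.
by rewrite !mulmxA mul_mxunit eq_sym (negPf fc) scale0r !mul0mx.
Qed.

(** On the isotypic component [rG h] is a combination of matrix units, and multiplying [spread a Y]
    by a matrix unit on either side gives the same product. *)
Lemma commutes_spread a Y : centralizes_repr (spread a Y).
Proof.
move=> h Gh.
have l : isotypic_idem *m spread a Y = spread a Y.
  rewrite mulmx_suml; apply: eq_bigr => b _.
  by rewrite mxunit_spread.
have r : spread a Y *m isotypic_idem = spread a Y.
  rewrite mulmx_sumr; apply: eq_bigr => b _.
  by rewrite spread_mxunit.
have hE : rG h *m isotypic_idem = \sum_b \sum_c D h c b *: mxunit c b.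
  by rewrite mulmx_sumr; apply: eq_bigr => b _; apply: mul_repr_mxunit.
rewrite -{1}r -{2}l -mulmxA -isotypic_comm // [RHS]mulmxA hE.
rewrite [LHS]mulmx_sumr [RHS]mulmx_suml; apply: eq_bigr => b _.
rewrite [LHS]mulmx_sumr [RHS]mulmx_suml; apply: eq_bigr => c _.
by rewrite -scalemxAr -scalemxAl spread_mxunit mxunit_spread.
Qed.

End MatrixUnits.

(** * The adjacency algebra of the orbitals as the commutant of the group *)

Section AdjacencyAlgebra.

Variable T : finType.
Implicit Types (S : {set {set T * T}}) (A : 'M[algC]_#|T|).

Lemma adj_algP S A :
  reflect (exists f : {set T * T} -> algC, A = \sum_(s in S) f s *: adjmx s)
          (A \in adj_alg S)%MS.
Proof.
apply: (iffP memmx_sumsP) => [[B -> adjB]|[f ->]]; last first.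
  exists (fun s => if s \in S then f s *: adjmx s else 0) => [|s].
    by apply: eq_bigr => s ->.
  case: ifP => _; last by rewrite linear0 sub0mx.
  by rewrite genmxE linearZ scalemx_sub.
have fP s : {a | B s = a *: adjmx s}.
  apply: sig_eqW; have := adjB s; rewrite genmxE => /sub_rVP[a].
  by rewrite -linearZ => /(can_inj mxvecK) ->; exists a.
by exists (fun s => sval (fP s)); apply: eq_bigr => s _; case: (fP s).
Qed.

Lemma submodule_adj_alg S U A :
  submodule S U -> (A \in adj_alg S)%MS -> (U *m A^T <= U)%MS.
Proof.
move=> modU /adj_algP[f ->]; rewrite raddf_sum mulmx_sumr summx_sub //= => s Ss.
by rewrite linearZ -scalemxAr scalemx_sub ?modU.
Qed.

Definition perm_repr_fun (g : {perm T}) : 'M[algC]_#|T| :=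
  \matrix_(i, j) (g (enum_val i) == enum_val j)%:R.

Lemma perm_repr_subproof (G : {group {perm T}}) : mx_repr G perm_repr_fun.
Proof.
split=> [|g h _ _]; apply/matrixP=> i j; rewrite !mxE.
  by rewrite perm1 (inj_eq enum_val_inj).
rewrite (bigD1 (enum_rank (g (enum_val i)))) //= big1 => [|l gil].
  by rewrite !mxE enum_rankK eqxx mul1r addr0 permM.
rewrite !mxE; case: eqP => [gl|_]; last by rewrite mul0r.
by rewrite gl enum_valK eqxx in gil.
Qed.

Definition perm_repr G := MxRepresentation (perm_repr_subproof G).

Lemma mxtrace_perm_repr (g : {perm T}) :
  \tr (perm_repr_fun g) = #|[set x | g x == x]|%:R.
Proof.
rewrite /mxtrace (reindex (@enum_rank T)) /=; last exact/onW_bij/enum_rank_bij.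
under eq_bigr do rewrite mxE enum_rankK.
rewrite -natr_sum -sum1dep_card [in RHS]big_mkcond; congr _%:R.
Qed.

Lemma perm_repr_commutesP (g : {perm T}) A :
  reflect (forall i j, A (enum_rank (g i)) (enum_rank (g j)) =
                       A (enum_rank i) (enum_rank j))
          (A *m perm_repr_fun g == perm_repr_fun g *m A).
Proof.
have l i j : (A *m perm_repr_fun g) i (enum_rank (g j)) = A i (enum_rank j).
  rewrite mxE (bigD1 (enum_rank j)) //= big1 => [|t tj].
    by rewrite !mxE !enum_rankK eqxx mulr1 addr0.
  rewrite !mxE !enum_rankK (inj_eq perm_inj); case: eqP => [ej|]; rewrite ?mulr0 //.
  by rewrite -ej enum_valK eqxx in tj.
have r i j : (perm_repr_fun g *m A) (enum_rank i) j = A (enum_rank (g i)) j.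
  rewrite mxE (bigD1 (enum_rank (g i))) //= big1 => [|t tj].
    by rewrite !mxE !enum_rankK eqxx mul1r addr0.
  rewrite !mxE !enum_rankK; case: eqP => [ej|]; rewrite ?mul0r //.
  by rewrite ej enum_valK eqxx in tj.
apply: (iffP eqP) => [cA i j | cA]; first by rewrite -r -cA l.
apply/matrixP=> i j; rewrite -(enum_valK i) -(enum_valK j).
by rewrite -(permKV g (enum_val j)) l r cA.
Qed.

Variable G : {group {perm T}}.

Definition orbital (x : T * T) : {set T * T} :=
  [set ((g : {perm T}) x.1, g x.2) | g in G].

Lemma orbital_refl x : x \in orbital x.
Proof. by apply/imsetP; exists 1%g; rewrite ?group1 // !perm1; case: x. Qed.

Lemma mem_orbitals x : orbital x \in orbitals G.
Proof. exact: imset_f. Qed.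

Lemma orbitals_eq s x : s \in orbitals G -> x \in s -> s = orbital x.
Proof.
case/imsetP=> y _ -> /imsetP[g Gg ->]; apply/setP=> z.
apply/imsetP/imsetP=> -[h Gh ->] /=.
  by exists (g^-1 * h)%g; rewrite ?groupM ?groupV // !permM !permK.
by exists (g * h)%g; rewrite ?groupM // !permM.
Qed.

Lemma orbital_act g x : g \in G -> orbital (g x.1, g x.2) = orbital x.
Proof.
by move=> Gg; apply/esym/orbitals_eq; [apply: mem_orbitals | apply: imset_f].
Qed.

Lemma orbitals_sumE (f : {set T * T} -> algC) i j :
  (\sum_(s in orbitals G) f s *: adjmx s) (enum_rank i) (enum_rank j)
  = f (orbital (i, j)).
Proof.
rewrite summxE (bigD1 (orbital (i, j))) ?mem_orbitals //= big1 => [|s].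
  by rewrite !mxE !enum_rankK orbital_refl mulr1 addr0.
case/andP=> Ss s_neq; rewrite !mxE !enum_rankK.
case: (boolP (_ \in s)) => [ijs|]; last by rewrite mulr0.
by rewrite (orbitals_eq Ss ijs) eqxx in s_neq.
Qed.

(** A matrix commutes with [G] exactly when its entries are constant on each orbital. *)
Lemma adj_alg_orbitalsP A :
  (A \in adj_alg (orbitals G))%MS <-> centralizes_repr (perm_repr G) A.
Proof.
split=> [/adj_algP[f ->] g Gg | cA].
  apply/eqP/perm_repr_commutesP => i j.
  by rewrite !orbitals_sumE (orbital_act (i, j)).
(* [f] reads the entry of [A] at some pair of [s]; the default 0 concerns only the empty set, which
   is not an orbital. *)
apply/adj_algP; pose f (s : {set T * T}) :=
  if [pick x in s] is Some x then A (enum_rank x.1) (enum_rank x.2) else 0.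
exists f; apply/matrixP=> i j; rewrite -(enum_valK i) -(enum_valK j).
rewrite orbitals_sumE /f; case: pickP => [x|/(_ (enum_val i, enum_val j))].
  case/imsetP=> g Gg -> /=; apply/esym/perm_repr_commutesP/eqP.
  exact: cA.
by rewrite orbital_refl.
Qed.

End AdjacencyAlgebra.

(** * Irreducible submodules cut out by the diagonal matrix units *)

Section IrreducibleSubmodule.

Variables (T : finType) (G : {group {perm T}}) (d : nat).
Variable (D : mx_representation algC G d).
Hypothesis irrD : mx_irreducible D.

Local Notation S := (orbitals G).
Local Notation e := (mxunit (perm_repr G) D).
Local Notation P := (isotypic_idem (perm_repr G) D).

Variable a : 'I_d.

Lemma central_submodule E : centralizes_repr (perm_repr G) E -> central_in S E ->
  submodule S (E *m e a a)^T.
Proof.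
move=> cE zE s Ss; rewrite -trmx_mul.
have adjs : (adjmx s \in adj_alg S)%MS.
  apply/adj_algP; exists (fun t => (t == s)%:R).
  rewrite (bigD1 s) //= eqxx scale1r big1 ?addr0 // => t /andP[_ /negPf->].
  by rewrite scale0r.
have /adj_alg_orbitalsP cs := adjs.
rewrite mulmxA -zE // -mulmxA (commutes_mxunit _ _ _ cs).
by rewrite mulmxA trmx_mul submxMl.
Qed.

(** The column space of [e a a] is the multiplicity space of [D]; through [spread] the commutant
    induces every endomorphism of it, so any nonzero vector generates it. *)
Lemma mxunit_irr_submodule : P != 0 -> irr_submodule S (e a a)^T.
Proof.
move=> P_neq0; have ee := mul_mxunit (perm_repr G) irrD.
split=> [|| V modV sVe].
- rewrite -[e a a]mul1mx; apply: central_submodule => [g _ | A _].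
    by rewrite mul1mx mulmx1.
  by rewrite mul1mx mulmx1.
- apply: contraNneq P_neq0 => /eqP; rewrite trmx_eq0 => /eqP e0.
  by rewrite -mxrank_eq0 (mxrank_isotypic _ irrD a) e0 mxrank0 muln0.
have [-> | V_neq0] := eqVneq V 0; [by left | right].
pose v := nz_row V; have sVv : (v <= V)%MS by apply: nz_row_sub.
have /rV0Pn[l vl] : v != 0 by rewrite nz_row_eq0.
have ev : e a a *m v^T = v^T.
  have /submxP[w ->] := submx_trans sVv sVe.
  by rewrite trmx_mul trmxK mulmxA ee eqxx scale1r.
apply/row_subP=> i; pose x := row i (e a a)^T.
(* [Y] is chosen to send [v^T] to [x^T]; the pivot [v 0 l] is nonzero. *)
pose Y := ((v 0 l)^-1 *: delta_mx l 0 *m x)^T.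
have Yv : Y *m v^T = x^T.
  rewrite /Y -trmx_mul mulmxA -scalemxAr -colE; congr trmx.
  rewrite -scalemxAl; apply/rowP=> j; rewrite !mxE big_ord1 !mxE.
  by rewrite mulrA mulVf ?mul1r.
have ex : e a a *m x^T = x^T.
  by rewrite /x -tr_col trmxK colE mulmxA ee eqxx scale1r.
have -> : row i (e a a)^T = v *m (spread (perm_repr G) D a Y)^T.
  apply: trmx_inj; rewrite trmx_mul trmxK -{1}ev mulmxA spread_mxunit //.
  by rewrite -!mulmxA ev Yv ex.
apply: submx_trans (submxMr _ sVv) _; apply: submodule_adj_alg modV _.
by apply/adj_alg_orbitalsP; apply: commutes_spread.
Qed.

(** By irreducibility a central idempotent [E] acts as 0 or 1 on the image of [e a a]; the units
    [e b a] and [e a b] carry the same alternative to every [e b b], hence to [P]. *)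
Lemma isotypic_central_prim : P != 0 -> central_prim_idem S P.
Proof.
move=> P_neq0; have ee := mul_mxunit (perm_repr G) irrD.
have [_ _ irr_e] := mxunit_irr_submodule P_neq0.
split=> //.
- by apply/adj_alg_orbitalsP => g Gg; rewrite isotypic_comm.
- exact: isotypic_idemK.
- by move=> A /adj_alg_orbitalsP cA; rewrite commutes_isotypic.
move=> E /adj_alg_orbitalsP cE EE zE.
have eE b : E *m e b b = e b a *m (E *m e a a) *m e a b.
  by rewrite mulmxA -commutes_mxunit // -!mulmxA ee eqxx scale1r ee eqxx scale1r.
have [||Ee0|/submxP[X eX]] := irr_e (E *m e a a)^T.
- exact: central_submodule.
- by rewrite commutes_mxunit // trmx_mul submxMl.
- left; rewrite mulmx_sumr big1 // => b _.
  by rewrite eE -[E *m e a a]trmxK Ee0 trmx0 mulmx0 mul0mx.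
(* Here the image of [e a a] lies in that of [E], so the idempotent [E] fixes it. *)
have {}eX : e a a = E *m e a a *m X^T by apply: trmx_inj; rewrite trmx_mul trmxK.
have Ee : E *m e a a = e a a by rewrite {1}eX !mulmxA EE -eX.
right; rewrite mulmx_sumr; apply: eq_bigr => b _.
by rewrite eE Ee !ee !eqxx !scale1r ee eqxx scale1r.
Qed.

Lemma mxunit_corresponds : corresponds P (e a a)^T.
Proof. by rewrite /corresponds -(mul_isotypic_mxunit _ irrD) trmx_mul submxMl. Qed.

End IrreducibleSubmodule.

(** * The permutation character and the pseudocyclic condition *)

Section CharacterSums.

Variables (T : finType) (G : {group {perm T}}).
Hypothesis trG : [transitive G, on [set: T] | 'P].

Local Notation S := (orbitals G).
Local Notation rho := (perm_repr G).
Local Notation P i := (isotypic_idem rho 'Chi_i).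

Lemma isotypic_idem_chi (i : Iirr G) :
  P i = #|G|%:R^-1 *: \sum_(g in G) ('chi_i 1%g * 'chi_i g^-1%g) *: rho g.
Proof.
rewrite isotypic_idemE irr1_degree mulrC -scalerA scaler_sumr; congr (_ *: _).
by apply: eq_bigr => g Gg; rewrite scalerA -{1}irrRepr cfunE groupV Gg mulr1n.
Qed.

(** The weights ['chi_i 1 * 'chi_i g^-1] add up to the regular character, which vanishes off the
    identity. *)
Lemma isotypic_idem_sum : \sum_i P i = 1%:M.
Proof.
under eq_bigr do rewrite isotypic_idem_chi.
rewrite -scaler_sumr exchange_big /=.
rewrite (eq_bigr (fun g => cfReg G g^-1%g *: rho g)) => [|g Gg]; last first.
  rewrite -scaler_suml cfReg_sum sum_cfunE; congr (_ *: _).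
  by apply: eq_bigr => i _; rewrite cfunE.
rewrite (bigD1 1%g) //= big1 => [|g /andP[_ g_neq1]]; last first.
  by rewrite cfRegE invg_eq1 (negPf g_neq1) mulr0n scale0r.
rewrite invg1 cfRegE eqxx mulr1n addr0 scalerA mulVf ?neq0CG // scale1r.
exact: (repr_mx1 rho).
Qed.

(** The elements carrying [x] to [y] form a coset of the stabiliser of [x], which has index [#|T|]
    by transitivity. *)
Lemma card_transporter x y : (#|[set g in G | g x == y]| * #|T| = #|G|)%N.
Proof.
have oT z : orbit 'P G z = [set: T] by apply: (atransP trG); rewrite inE.
have /imsetP[h Gh ->]: y \in orbit 'P G x by rewrite oT inE.
rewrite -(card_orbit_stab 'P G x) oT cardsT mulnC; congr (_ * _)%N.
rewrite -[RHS](card_rcoset _ h); apply: eq_card => g.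
rewrite [in RHS]mem_rcoset !inE.
rewrite groupMr ?groupV //; congr (_ && _); rewrite sub1set inE /= /aperm permM.
by rewrite -[in RHS](inj_eq (@perm_inj _ h)) permKV.
Qed.

Lemma card_domain_neq0 (x : T) : #|T|%:R != 0 :> algC.
Proof. by rewrite pnatr_eq0 -lt0n; apply/card_gt0P; exists x. Qed.

Lemma isotypic_idem0 : P 0 = Jn T.
Proof.
apply/matrixP=> i j; rewrite isotypic_idem_chi /Jn !mxE mulr1.
rewrite summxE (eq_bigr (fun g : {perm T} => (g (enum_val i) == enum_val j)%:R)).
  rewrite -natr_sum -big_mkcondr sum1dep_card /=.
  rewrite -(card_transporter (enum_val i) (enum_val j)) natrM invfM.
  rewrite mulrAC mulVf ?mul1r // pnatr_eq0 -lt0n.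
  have := cardG_gt0 G; rewrite -(card_transporter (enum_val i) (enum_val j)).
  by rewrite muln_gt0 => /andP[].
by move=> g Gg; rewrite !mxE irr0 !cfun1E group1 groupV Gg !mul1r.
Qed.

(** Needed because [pseudocyclic] constrains only idempotents other than [Jn T]. Every [rho g] fixes
    [Jn T], so [P i *m Jn T] is a multiple of the sum of the ['chi_i g^-1], which is 0 for a
    nonprincipal character. *)
Lemma isotypic_idem_neq_Jn i : i != 0 -> P i != 0 -> P i != Jn T.
Proof.
move=> i_neq0; apply: contraNneq => PJ.
have JJ : Jn T *m Jn T = Jn T.
  by rewrite -isotypic_idem0; apply/isotypic_idemK/socle_irr.
rewrite PJ -JJ -{1}PJ isotypic_idem_chi -scalemxAl mulmx_suml.
rewrite (eq_bigr (fun g => ('chi_i 1%g * 'chi_i g^-1%g) *: Jn T)) => [|g Gg].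
  rewrite -scaler_suml -mulr_sumr.
  have := first_orthogonality_relation 0 i.
  rewrite eq_sym (negPf i_neq0) => /eqP.
  rewrite mulf_eq0 invr_eq0 (negPf (neq0CG _)) /=.
  rewrite (eq_bigr (fun g => 'chi_i g^-1%g)) => [/eqP->|g Gg].
    by rewrite mulr0 scale0r scaler0.
  by rewrite irr0 cfun1E Gg mul1r.
rewrite -scalemxAl; congr (_ *: _); apply/matrixP=> k l; rewrite !mxE.
rewrite (bigD1 (enum_rank (g (enum_val k)))) //= big1 => [|t tk].
  by rewrite !mxE enum_rankK eqxx mul1r addr0.
rewrite !mxE; case: eqP => [gk|_]; last by rewrite mul0r.
by rewrite gk enum_valK eqxx in tk.
Qed.

Definition fixed (g : {perm T}) : {set T} := [set x | g x == x].

Lemma fixedV g : fixed g^-1 = fixed g.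
Proof.
by apply/setP=> x; rewrite !inE -(inj_eq (@perm_inj _ g)) permKV eq_sym.
Qed.

Definition perm_char : 'CF(G) := cfRepr rho.

Lemma perm_charE g : g \in G -> perm_char g = #|fixed g|%:R.
Proof. by move=> Gg; rewrite cfunE Gg mulr1n mxtrace_perm_repr. Qed.

Lemma mxtrace_isotypic i : \tr (P i) = 'chi_i 1%g * '[perm_char, 'chi_i].
Proof.
rewrite isotypic_idem_chi mxtraceZ raddf_sum cfdotE mulrCA; congr (_ * _).
rewrite mulr_sumr; apply: eq_bigr => g Gg /=.
rewrite mxtraceZ mxtrace_perm_repr -perm_charE // irr_inv -!mulrA; congr (_ * _).
by rewrite mulrC.
Qed.

Lemma mxrank_mxunit_chi i a :
  (\rank (mxunit rho 'Chi_i a a))%:R = '[perm_char, 'chi_i].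
Proof.
have irrD := socle_irr (socle_of_Iirr i).
apply: (mulfI (irr1_neq0 i)); rewrite -mxtrace_isotypic.
rewrite (mxtrace_idem (isotypic_idemK _ irrD)) (mxrank_isotypic _ irrD a).
by rewrite natrM irr1_degree.
Qed.

(** With r the multiplicity of ['chi_i] in [perm_char], the two ranks are ['chi_i 1 * r] and [r], so
    the ratio in [pseudocyclic] is ['chi_i 1 / r]. *)
Lemma pseudocyclic_multiplicity : pseudocyclic S ->
  exists c : algC, forall i : Iirr G, i != 0 -> P i != 0 ->
    'chi_i 1%g = c * '[perm_char, 'chi_i].
Proof.
case=> c cP; exists (ratr c) => i i_neq0 Pi_neq0.
pose a := Ordinal (irr_degree_gt0 (socle_of_Iirr i)).
have irrD := socle_irr (socle_of_Iirr i).
have := cP _ _ (isotypic_central_prim irrD a Pi_neq0)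
  (isotypic_idem_neq_Jn i_neq0 Pi_neq0) (mxunit_irr_submodule irrD a Pi_neq0)
  (mxunit_corresponds irrD a).
rewrite mxrank_tr (mxrank_isotypic _ irrD a).
have r_neq0 : '[perm_char, 'chi_i] != 0.
  apply: contraNneq Pi_neq0 => r0; rewrite -mxrank_eq0 (mxrank_isotypic _ irrD a).
  by rewrite -(eqr_nat algC) natrM mxrank_mxunit_chi r0 mulr0.
move=> <-; rewrite fmorph_div rmorphXn !rmorph_nat natrM mxrank_mxunit_chi.
rewrite -irr1_degree expr2; move: ('[_, _]) r_neq0 => r r_neq0.
by rewrite invfM mulrA mulfK // mulfVK.
Qed.

Lemma pseudocyclic_sum : pseudocyclic S ->
  exists c : algC, forall x y : T,
    (x == y)%:R - #|T|%:R^-1 =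
    c / #|G|%:R * \sum_(g in G | g x == y) (#|fixed g|%:R - 1).
Proof.
move=> /pseudocyclic_multiplicity[c cP]; exists c => x y.
have sumP : 1%:M - Jn T = c / #|G|%:R *:
    \sum_(g in G) (#|fixed g|%:R - 1) *: rho g.
  rewrite -isotypic_idem_sum (bigD1 0) //= isotypic_idem0 [LHS]addrC addKr.
  transitivity (\sum_(i : Iirr G | i != 0) c / #|G|%:R *:
      \sum_(g in G) ('[perm_char, 'chi_i] * 'chi_i g^-1%g) *: rho g).
    (* Characters absent from [perm_char] contribute 0 on both sides. *)
    apply: eq_bigr => i i_neq0; have [Pi0|Pi_neq0] := eqVneq (P i) 0.
      have := mxtrace_isotypic i; rewrite Pi0 mxtrace0 => /esym/eqP.
      rewrite mulf_eq0 (negPf (irr1_neq0 i)) => /eqP->.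
      by rewrite big1 ?scaler0 // => g _; rewrite mul0r scale0r.
    rewrite isotypic_idem_chi [c / _]mulrC -scalerA [c *: _]scaler_sumr.
    congr (_ *: _).
    by apply: eq_bigr => g _; rewrite scalerA cP // -mulrA.
  rewrite -scaler_sumr exchange_big; congr (_ *: _); apply: eq_bigr => g Gg /=.
  rewrite -scaler_suml; congr (_ *: _).
  (* Expand [perm_char] at [g^-1], which has the same fixed points as [g]; the principal character,
     of multiplicity 1, accounts for the [- 1]. *)
  have /cfunP/(_ g^-1%g) := cfun_sum_cfdot perm_char.
  rewrite perm_charE ?groupV // fixedV sum_cfunE (bigD1 0) //= => ->.
  have -> : '[perm_char, 'chi_0] = 1.
    have := mxtrace_isotypic 0; rewrite isotypic_idem0 irr0 cfun11 mul1r => <-.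
    rewrite /Jn mxtraceZ /mxtrace; under eq_bigr do rewrite mxE.
    by rewrite sumr_const card_ord mulVf // (card_domain_neq0 x).
  rewrite cfunE irr0 cfun1E groupV Gg mulr1 addrC addrK.
  by apply: eq_bigr => i _; rewrite cfunE.
move/matrixP/(_ (enum_rank x) (enum_rank y)): sumP.
rewrite !mxE (inj_eq enum_rank_inj) mulr1 => ->; congr (_ * _).
rewrite summxE big_mkcondr; apply: eq_bigr => g _.
by rewrite !mxE !enum_rankK; case: eqP; rewrite ?mulr1 ?mulr0.
Qed.

End CharacterSums.

(** For a diagonal entry of [pseudocyclic_sum]: [n] stands for [#|T| - 1] and [m * k * (n + 1)] for
    [#|G|]. *)
Lemma eigenvalue_ratio (F : fieldType) (m k n c : F) :
  m != 0 -> k != 0 -> n != 0 -> n + 1 != 0 ->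
  1 - (n + 1)^-1 = c / (m * k * (n + 1)) * (n * m) -> c = k.
Proof.
move=> m0 k0 n0 n1 E.
have -> : c = k * (c / (m * k * (n + 1)) * (n * m)) * (n + 1) / n.
  by field; rewrite n0 k0 m0 n1.
by rewrite -E; field; rewrite n0 n1.
Qed.

(** For an off-diagonal entry: here [n] is [#|T|] itself and [f] the sum of fixed-point counts over
    a transporter. *)
Lemma fixed_sum_solve (F : fieldType) (m k n f : F) :
  m != 0 -> k != 0 -> n != 0 ->
  - n^-1 = k / (m * k * n) * (f - m * k) -> f + m = k * m.
Proof.
move=> m0 k0 n0 E.
have -> : f = m * n * (k / (m * k * n) * (f - m * k)) + m * k.
  by field; rewrite k0 m0 n0.
by rewrite -E; field.
Qed.

(** * Counting fixed points *)

Section FixedPoints.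

Variables (T : finType) (G : {group {perm T}}) (k : nat).
Hypothesis trG : [transitive G, on [set: T] | 'P].
Hypothesis pcS : pseudocyclic (orbitals G).
Hypothesis diagS : diag T \in orbitals G.
Hypothesis valS : forall s, s \in orbitals G -> s != diag T ->
  forall a, valency_at s a = k.
Hypothesis k_gt1 : (1 < k)%N.

Definition transporter (x y : T) := [set g in G | g x == y].
Definition stab2 (x y : T) := [set g in G | (g x == x) && (g y == y)].

(** Orbit-stabiliser for the stabiliser of [x]: the orbit of [y] is the neighbourhood of [x] in the
    orbital of [(x, y)], of size [k]. *)
Lemma card_stab2 x y : x != y -> (#|stab2 x y| * k)%N = #|transporter x x|.
Proof.
move=> xy; pose K := 'C_G[x | 'P]%G.
have KE g : (g \in K) = (g \in G) && (g x == x) by rewrite !inE sub1set inE.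
have -> : transporter x x = K by apply/setP=> g; rewrite KE !inE.
have -> : stab2 x y = 'C_K[y | 'P]%g.
  by apply/setP=> g; rewrite 2!inE KE !inE sub1set inE -!andbA.
rewrite -(card_orbit_stab 'P K y) mulnC; congr (_ * _)%N.
have s_neq : orbital G (x, y) != diag T.
  apply: contraNneq xy => sd; have := orbital_refl G (x, y).
  by rewrite sd inE.
rewrite -(valS (mem_orbitals _ _) s_neq x) /valency_at; apply: eq_card => z.
rewrite inE; apply/imsetP/imsetP => [[g Gg [xg ->]] | [g]].
  by exists g; rewrite // KE Gg -xg eqxx.
by rewrite KE => /andP[Gg /eqP gx] ->; exists g; rewrite //= gx.
Qed.

(** The valencies at [x] add up to [#|T|]; the diagonal contributes 1 and every other orbital
    [k]. *)
Lemma card_points_orbitals (x : T) : #|T|.-1 = (k * #|orbitals G|.-1)%N.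
Proof.
have sum_val : (\sum_(s in orbitals G) valency_at s x)%N = #|T|.
  under eq_bigr do rewrite /valency_at -sum1dep_card big_mkcond /=.
  rewrite exchange_big -sum1_card; apply: eq_bigr => y _ /=.
  rewrite (bigD1 (orbital G (x, y))) ?mem_orbitals //= orbital_refl big1 // => s.
  case/andP=> Ss; case: ifP => // /(orbitals_eq Ss) ->.
  by rewrite eqxx.
rewrite -sum_val (bigD1 (diag T)) //= (eq_bigr (fun _ => k)); last first.
  by move=> s /andP[Ss s_neq]; apply: valS.
rewrite sum_nat_const [in RHS](cardD1 (diag T)) diagS add1n /= mulnC.
have -> : valency_at (diag T) x = 1%N.
  rewrite /valency_at -(cards1 x); apply: eq_card => y.
  by rewrite !inE eq_sym.
by rewrite add1n /=; congr (_ * _)%N; apply: eq_card => s; rewrite !inE andbC.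
Qed.

Lemma sum_fixed (A : {set {perm T}}) :
  (\sum_(g in A) #|fixed g| = \sum_x #|[set g in A | g x == x]|)%N.
Proof.
under eq_bigr do rewrite -sum1dep_card big_mkcond /=.
rewrite exchange_big; apply: eq_bigr => x _ /=.
by rewrite -big_mkcondr sum1dep_card.
Qed.

Variables x0 y0 : T.
Hypothesis xy0 : x0 != y0.

Definition stab2_order := #|stab2 x0 y0|.
Local Notation m := stab2_order.

Lemma card_transporterE x y : #|transporter x y| = (m * k)%N.
Proof.
rewrite card_stab2 //; have := cardG_gt0 G; rewrite -(card_transporter trG x0 x0).
rewrite muln_gt0 => /andP[_ n_gt0]; apply/eqP.
by rewrite -(eqn_pmul2r n_gt0) !card_transporter.
Qed.

Lemma card_stab2E x y : x != y -> #|stab2 x y| = m.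
Proof.
move=> xy; apply/eqP; rewrite -(@eqn_pmul2r k) ?(ltnW k_gt1) //.
by rewrite card_stab2 // card_transporterE.
Qed.

Lemma stab2_order_gt0 : (0 < m)%N.
Proof. by apply/card_gt0P; exists 1%g; rewrite inE group1 !perm1 !eqxx. Qed.

Lemma card_points_gt1 : (1 < #|T|)%N.
Proof. by rewrite (cardD1 x0) (cardD1 y0) !inE eq_sym xy0. Qed.

(** Double counting: [x] is fixed by the whole stabiliser, and every other point by [m] of its
    elements. *)
Lemma sum_fixed_stab x :
  (\sum_(g in transporter x x) #|fixed g| = m * k + #|T|.-1 * m)%N.
Proof.
rewrite sum_fixed (bigD1 x) //=; congr (_ + _)%N.
  rewrite -(card_transporterE x x); apply: eq_card => g.
  by rewrite !inE -andbA andbb.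
rewrite (eq_bigr (fun _ => m)) => [|y yx]; last first.
  rewrite -(@card_stab2E x y) 1?eq_sym //; apply: eq_card => g.
  by rewrite !inE -andbA.
by rewrite sum_nat_const cardC1.
Qed.

Lemma sum_fixed_transporter x y : x != y ->
  (\sum_(g in transporter x y) #|fixed g| + m = k * m)%N.
Proof.
move=> xy; have [c cE] := pseudocyclic_sum trG pcS.
have sumE u v : \sum_(g in G | g u == v) (#|fixed g|%:R - 1) =
    (\sum_(g in transporter u v) #|fixed g|)%:R - (m * k)%:R :> algC.
  rewrite -(card_transporterE u v) -sum1_card !natr_sum -sumrB.
  by apply: eq_bigl => g; rewrite inE.
have n_neq0 := card_domain_neq0 x.
have m_neq0 : m%:R != 0 :> algC by rewrite pnatr_eq0 -lt0n stab2_order_gt0.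
have k_neq0 : k%:R != 0 :> algC by rewrite pnatr_eq0 -lt0n ltnW.
have GE : #|G|%:R = m%:R * k%:R * #|T|%:R :> algC.
  by rewrite -(card_transporter trG x x) card_transporterE !natrM.
have n1_neq0 : #|T|.-1%:R != 0 :> algC.
  by rewrite pnatr_eq0 -lt0n -subn1 subn_gt0 card_points_gt1.
have nE : #|T|%:R = #|T|.-1%:R + 1 :> algC.
  by rewrite natr1 prednK // ltnW ?card_points_gt1.
(* A diagonal entry of [pseudocyclic_sum] determines [c]. *)
have ck : c = k%:R.
  have := cE x x; rewrite eqxx sumE sum_fixed_stab natrD addrAC subrr add0r.
  rewrite GE natrM.
  move: n_neq0; rewrite nE => n_neq0 cxx.
  exact: (eigenvalue_ratio m_neq0 k_neq0 n1_neq0 n_neq0 cxx).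
have := cE x y; rewrite (negPf xy) sumE ck GE.
rewrite natrM sub0r => cxy; apply/eqP; rewrite -(eqr_nat algC) natrD natrM.
by apply/eqP; exact: (fixed_sum_solve m_neq0 k_neq0 n_neq0 cxy).
Qed.

Lemma card_fixed h : h \in G -> h != 1%g -> (#|fixed h| < k)%N.
Proof.
move=> Gh h_neq1; have /existsP[x hx] : [exists x, h x != x].
  apply: contraNT h_neq1; rewrite negb_exists => /forallP h1.
  by apply/eqP/permP => x; rewrite perm1; apply/eqP; rewrite -[_ == _]negbK h1.
have xh : x != h x by rewrite eq_sym.
have m_gt0 := stab2_order_gt0.
(* The right-hand sum is [(k - 1) * m], and [m] is positive. *)
suff : (#|fixed h| * m <= \sum_(g in transporter x (h x)) #|fixed g|)%N.
  move: (sum_fixed_transporter xh); nia.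
rewrite sum_fixed -sum_nat_const [leqRHS](bigID (mem (fixed h))) /=.
apply: leq_trans (leq_addr _ _); apply: leq_sum => z; rewrite inE => /eqP hz.
have xz : x != z by apply: contraNneq hx => ->; rewrite hz.
(* Right multiplication by [h] embeds [stab2 x z] into the elements that carry [x] to [h x] and fix
   [z]. *)
rewrite -(card_stab2E xz) -(card_imset _ (mulIg h)); apply/subset_leq_card.
apply/subsetP=> _ /imsetP[g + ->]; rewrite !inE !permM => /and3P[Gg /eqP-> /eqP->].
by rewrite groupM // hz !eqxx.
Qed.

Lemma stab2_trivial : (2 * (k - 1) < #|orbitals G|)%N -> m = 1%N.
Proof.
move=> rank_gt; have n1E := card_points_orbitals x0.
have n_gt1 := card_points_gt1; have m_gt0 := stab2_order_gt0.
(* The identity fixes all of [T], and each of the other [m * k - 1] elements at most [k - 1]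
   points. *)
have : (\sum_(g in transporter x0 x0) #|fixed g| <= #|T| + (m * k).-1 * k.-1)%N.
  have t1 : 1%g \in transporter x0 x0 by rewrite inE group1 perm1 eqxx.
  rewrite -(card_transporterE x0 x0) (cardD1 1%g) t1 add1n /= (bigD1 1%g) //=.
  apply: leq_add; first exact: max_card.
  rewrite -sum_nat_const.
  apply: (@leq_trans (\sum_(g in transporter x0 x0 | g != 1%g) k.-1)%N).
    apply: leq_sum => g; rewrite inE => /andP[/andP[Gg _] g_neq1].
    by have := card_fixed Gg g_neq1; lia.
  rewrite (eq_bigl (fun g => g \in [predD1 transporter x0 x0 & 1%g])) // => g.
  by rewrite !inE andbC.
rewrite sum_fixed_stab n1E => le_m; apply/eqP; rewrite eqn_leq m_gt0 andbT leqNgt.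
apply/negP => m_gt1.
have [R RE] : exists R, #|orbitals G| = R.+1 by exists #|orbitals G|.-1; lia.
(* As [#|T| = k * R + 1], the bound reads [k * R * (m - 1) <= (m * k - 1) * (k - 2)]. But
   [R >= 2 * (k - 1)] and [2 * (m - 1) >= m] make the left side at least [m * k * (k - 1)]. *)
move: le_m rank_gt n1E; rewrite RE /=; move: m m_gt1 m_gt0 n_gt1 k_gt1 => u.
move: #|T| => n; clear; case: n => // n.
rewrite /=; case: k => // k1; case: u => // u; nia.
Qed.

(** With [m = 1], two-point stabilisers are trivial, while a point stabiliser has order [k > 1] and
    so contains a nonidentity element. *)
Lemma frobenius_of_rank : (2 * (k - 1) < #|orbitals G|)%N -> frobenius_perm G.
Proof.
move=> rank_gt; have m1 := stab2_trivial rank_gt; split=> //.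
  have : (1 < #|transporter x0 x0|)%N by rewrite card_transporterE m1 mul1n.
  rewrite (cardD1 1%g) inE group1 perm1 eqxx /= add1n ltnS => /card_gt0P[g].
  rewrite !inE => /and3P[g_neq1 Gg /eqP gx].
  by exists g => //; split=> //; exists x0.
move=> g Gg x y xy gx gy; have /eqP := card_stab2E xy; rewrite m1.
case/cards1P=> h sE; have : 1%g \in stab2 x y by rewrite inE group1 !perm1 !eqxx.
have : g \in stab2 x y by rewrite inE Gg gx gy !eqxx.
by rewrite sE !inE => /eqP-> /eqP.
Qed.

End FixedPoints.

(** * The automorphism group of a scheme *)

Lemma aut_schemeP (T : finType) (S : {set {set T * T}}) (f : {perm T}) :
  reflect (forall s x y, s \in S -> ((f x, f y) \in s) = ((x, y) \in s))
          (f \in aut_scheme S).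
Proof.
pose F (p : T * T) := (f p.1, f p.2).
have F_inj : injective F.
  by move=> [x y] [z t] [/perm_inj-> /perm_inj->].
rewrite inE; apply: (iffP forall_inP) => [fS s x y Ss | fS s Ss].
  by rewrite -{1}(eqP (fS s Ss)) (mem_imset _ (x, y) F_inj).
(* As [F] is injective, inclusion of the image in [s] already gives equality. *)
rewrite eqEcard card_imset ?leqnn // andbT.
by apply/subsetP=> _ /imsetP[[x y] sxy ->]; rewrite fS.
Qed.

Lemma aut_scheme_group_set (T : finType) (S : {set {set T * T}}) :
  group_set (aut_scheme S).
Proof.
apply/group_setP; split=> [|f g /aut_schemeP fS /aut_schemeP gS].
  by apply/aut_schemeP => s x y _; rewrite !perm1.
by apply/aut_schemeP => s x y Ss; rewrite !permM gS ?fS.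
Qed.

Lemma sub_aut_orbitals (T : finType) (G : {group {perm T}}) :
  G \subset aut_scheme (orbitals G).
Proof.
apply/subsetP=> g Gg; apply/aut_schemeP => s x y Ss.
apply/idP/idP => /(orbitals_eq Ss) ->.
  by rewrite (orbital_act (x, y)) ?orbital_refl.
by rewrite -(orbital_act (x, y) Gg) orbital_refl.
Qed.

(** Automorphisms preserve every orbital of [G], so passing to the larger group [A] merges no orbits
    on pairs. *)
Lemma orbitals_aut (T : finType) (G A : {group {perm T}}) :
  aut_scheme (orbitals G) = A -> orbitals A = orbitals G.
Proof.
move=> AE; have sGA : G \subset A by rewrite -AE sub_aut_orbitals.
have orbE x : orbital A x = orbital G x.
  apply/setP=> y; apply/imsetP/imsetP => -[g Gg ->]; last first.
    by exists g; rewrite // (subsetP sGA).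
  move: Gg; rewrite -AE => /aut_schemeP/(_ _ x.1 x.2 (mem_orbitals G x)).
  by rewrite -surjective_pairing orbital_refl => /imsetP.
by apply: eq_imset.
Qed.

Theorem theorem2p5 (T : finType) (S : {set {set T * T}}) (k : nat) :
  is_scheme S -> schurian S -> pseudocyclic S ->
  (forall s, s \in S -> s != diag T -> forall a, valency_at s a = k) ->
  (1 < k)%N -> (2 * (k - 1) < #|S|)%N ->
  frobenius_scheme S /\ frobenius_perm (aut_scheme S).
Proof.
move=> [_ diagS _ _] [G [trG GS]] pcS valS k_gt1 rank_gt.
(* The full automorphism group serves both conclusions, its scheme being again [S]. *)
pose A := Group (aut_scheme_group_set S).
have AS : orbitals A = S by rewrite (@orbitals_aut _ G A) ?GS.
have trA : [transitive A, on [set: T] | 'P].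
  have sGA : G \subset aut_scheme S by rewrite -GS sub_aut_orbitals.
  have -> := atrans_supgroup (sGA : G \subset A) trG.
  by apply/actsP => g _ x; rewrite !inE.
suff frobA : frobenius_perm A by split=> //; exists A.
(* The rank exceeds 2, so a nondiagonal relation exists; any pair in it supplies the two distinct
   base points that [frobenius_of_rank] requires. *)
have [s /andP[Ss s_neq]] : exists s, (s \in S) && (s != diag T).
  have : (1 < #|S|)%N by lia.
  rewrite (cardD1 (diag T)) diagS add1n ltnS => /card_gt0P[s].
  by rewrite !inE andbC; exists s.
have [[x y] xys] : exists p, p \in s.
  move: Ss; rewrite -AS => /imsetP[p _ ->]; exists p; exact: (orbital_refl A p).
have xy : x != y.
  apply: contraNneq s_neq => xy; apply/eqP.
  have : (x, y) \in diag T by rewrite inE xy.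
  rewrite -AS in Ss diagS.
  by rewrite (orbitals_eq Ss xys) => /(orbitals_eq diagS) ->.
by apply: (@frobenius_of_rank T A k) xy _; rewrite ?AS.
Qed.
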